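(* Consider the priority assignment that sets the priority of each item $x\in[n]$ to $\mathrm{pri}_x:=\mathbf{p}_x$, where $\mathbf{p}$ is a probability distribution on $[n]$, and let $T$ be the resulting Treap. There exists a distribution $\mathbf{p}$ on $[n]$ such that the expected access time $\mathbb{E}_{x\sim\mathbf{p}}[\mathrm{depth}(x)]=\Omega(n)$.
   Context: A Treap with distinct priorities is the unique binary search tree on the ordered keys $[n]$ in which every node's priority is at least the priorities of its descendants. $\mathrm{depth}(x)$ is the number of ancestors of $x$ in $T$ (including $x$). *)

(* Defs.v *)
From mathcomp Require Import all_boot all_order all_algebra.
From mathcomp Require Import reals.

Set Implicit Arguments.
Unset Strict Implicit.
Unset Printing Implicit Defensive.

Import Order.TTheory GRing.Theory Num.Theory.

Inductive tree (K : Type) : Type :=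
| Leaf
| Node of tree K & K & tree K.
Arguments Leaf {K}.

Fixpoint keys (K : Type) (t : tree K) : seq K :=
  if t is Node l k r then keys l ++ k :: keys r else [::].

(* [ancestor t a x]: some node of [t] labelled [a] has [x] in the subtree that
   it roots; the relation is reflexive on the keys of [t]. *)
Fixpoint ancestor (K : eqType) (t : tree K) (a x : K) : bool :=
  if t is Node l k r then
    [|| (a == k) && (x \in keys t), ancestor l a x | ancestor r a x]
  else false.

Definition depth (K : finType) (t : tree K) (x : K) : nat :=
  #|[set a | ancestor t a x]|.

(* The ordered key set {1, ..., n} is represented by 'I_n = {0, ..., n-1}. *)
Fixpoint is_bst (n : nat) (t : tree 'I_n) : bool :=
  if t is Node l k r then
    [&& all (fun y : 'I_n => y < k) (keys l),
        all (fun y : 'I_n => k < y) (keys r), is_bst l & is_bst r]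
  else true.

Local Open Scope ring_scope.

Definition is_treap (R : realType) (n : nat) (pri : 'I_n -> R)
    (t : tree 'I_n) : Prop :=
  [/\ is_bst t, forall x : 'I_n, x \in keys t
    & forall a x : 'I_n, ancestor t a x -> pri x <= pri a].

Definition is_distribution (R : realType) (n : nat) (p : 'I_n -> R) : Prop :=
  (forall x, 0 <= p x) /\ \sum_x p x = 1.

Definition expected_access_time (R : realType) (n : nat) (p : 'I_n -> R)
    (t : tree 'I_n) : R :=
  \sum_x p x * (depth t x)%:R.

(* Main.v *)
Require Import Defs.
From mathcomp Require Import all_boot all_order all_algebra.
From mathcomp Require Import reals.
From mathcomp Require Import ring lra.

Set Implicit Arguments.
Unset Strict Implicit.
Unset Printing Implicit Defensive.

Import Order.TTheory GRing.Theory Num.Theory.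
Local Open Scope ring_scope.

(** If the priorities decrease along the keys, the Treap degenerates to a path
    in which the i-th smallest key has depth i. Probabilities that decrease
    linearly, [p_i] proportional to [n - i] for [i < n], put enough mass on the
    deep keys: the expected depth is
    [(\sum_i (n - i) (i + 1)) / (\sum_i (n - i)) = (n + 2) / 3]. *)

Definition right_path (K : Type) (s : seq K) : tree K :=
  foldr (fun k t => Node Leaf k t) Leaf s.

Lemma keys_right_path (K : Type) (s : seq K) : keys (right_path s) = s.
Proof. by elim: s => //= k s ->. Qed.

(** The subtree at a node of the path holds the suffix of [s] that starts there; strict sortedness
    makes this suffix the set of keys of [s] not below that node. *)
Lemma ancestor_right_path n (s : seq 'I_n) (a x : 'I_n) :
  sorted (fun i j : 'I_n => (i < j)%N) s ->
  ancestor (right_path s) a x = [&& a \in s, x \in s & (a <= x)%N].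
Proof.
have tr : transitive (fun i j : 'I_n => (i < j)%N) by move=> j i k; apply: ltn_trans.
elim: s => //= k s IHs ks.
rewrite IHs ?(path_sorted ks) // keys_right_path !inE.
have lt_k y : y \in s -> (k < y)%N by apply/allP: y; exact: order_path_min ks.
have [-> | a_k] := eqVneq a k; have [-> | x_k] /= := eqVneq x k.
- by rewrite leqnn.
- case: (boolP (x \in s)) => [/lt_k /ltnW -> | _] //=.
  by rewrite andbF.
- case: (boolP (a \in s)) => [/lt_k | _] //=.
  by rewrite ltnNge => /negPf ->; rewrite andbF.
- by [].
Qed.

Lemma sorted_enum_ord n : sorted (fun i j : 'I_n => (i < j)%N) (enum 'I_n).
Proof.
have := iota_ltn_sorted 0 n.
by rewrite -val_enum_ord sorted_map.
Qed.

Lemma depth_right_path n (x : 'I_n) : depth (right_path (enum 'I_n)) x = x.+1.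
Proof.
rewrite /depth -[RHS](card_ord x.+1).
have widen_inj : injective (widen_ord (ltn_ord x)).
  by move=> i j /(congr1 val) /= /val_inj.
(* The ancestors of [x] are the keys [0, ..., x], that is, the image of ['I_x.+1] in ['I_n]; the
   successor appears because keys start at 0 and [x] counts itself. *)
rewrite -(card_imset _ widen_inj).
apply: eq_card => a; rewrite inE ancestor_right_path ?sorted_enum_ord //.
rewrite !mem_enum /=; apply/idP/imsetP => [ax | [i _ ->]].
  by exists (Ordinal (ax : (a < x.+1)%N)) => //; apply: val_inj.
by rewrite /= -ltnS.
Qed.

Lemma is_bst_right_path n (s : seq 'I_n) :
  sorted (fun i j : 'I_n => (i < j)%N) s -> is_bst (right_path s).
Proof.
elim: s => //= k s IHs ks.
rewrite keys_right_path IHs ?(path_sorted ks) // andbT.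
by apply: order_path_min ks => j i l; apply: ltn_trans.
Qed.

Lemma sorted_keys n (t : tree 'I_n) :
  is_bst t -> sorted (fun i j : 'I_n => (i < j)%N) (keys t).
Proof.
have tr : transitive (fun i j : 'I_n => (i < j)%N) by move=> j i k; apply: ltn_trans.
elim: t => //= l IHl k r IHr /and4P[lk kr /IHl sl /IHr sr].
rewrite !(sorted_pairwise tr) in sl sr *.
rewrite pairwise_cat /= sl sr kr !andbT.
apply/allrelP => i j il; rewrite inE => /orP[/eqP -> | jr].
  exact: (allP lk).
by apply: (ltn_trans (allP lk _ il)); apply: (allP kr).
Qed.

Section DecreasingPriorities.

Variables (R : realType) (n : nat) (pri : 'I_n -> R).
Hypothesis pri_decr : forall i j : 'I_n, (i < j)%N -> pri j < pri i.

Lemma decreasing_pri_le (i j : 'I_n) : (i <= j)%N -> pri j <= pri i.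
Proof.
by rewrite leq_eqVlt => /orP[/eqP/val_inj -> // | /pri_decr/ltW].
Qed.

Lemma decreasing_pri_inj : injective pri.
Proof.
move=> i j eq_ij; apply: val_inj.
by case: (ltngtP i j) => // /pri_decr; rewrite eq_ij ltxx.
Qed.

(** No node can have a left child: its key would be smaller than that of its parent, so its priority
    would be strictly larger, against the heap order. *)
Lemma decreasing_heap_right_path (t : tree 'I_n) :
  is_bst t -> (forall a x, ancestor t a x -> pri x <= pri a) ->
  t = right_path (keys t).
Proof.
elim: t => //= l _ k r IHr /and4P[lk _ _ bst_r] heap.
case: l lk heap => [_ heap | l y l' /allP lk heap] /=.
  rewrite -IHr // => a x ax.
  by apply: heap; rewrite ax !orbT.
have yl : y \in keys (Node l y l') by rewrite /= mem_cat mem_head orbT.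
have := pri_decr (lk y yl); rewrite ltNge heap //.
by rewrite eqxx mem_cat yl.
Qed.

Lemma decreasing_treap_unique : unique (is_treap pri) (right_path (enum 'I_n)).
Proof.
split.
  split=> [|x|a x].
  - exact/is_bst_right_path/sorted_enum_ord.
  - by rewrite keys_right_path mem_enum.
  - rewrite ancestor_right_path ?sorted_enum_ord // => /and3P[_ _].
    exact: decreasing_pri_le.
move=> t [bst_t all_t heap_t].
(* The shape being forced, only the key sequences remain to be compared: both are strictly
   increasing and contain all of ['I_n]. *)
rewrite (decreasing_heap_right_path bst_t heap_t); congr right_path.
apply: (@irr_sorted_eq _ (fun i j : 'I_n => (i < j)%N)).
- by move=> j i k; apply: ltn_trans.
- by move=> i; apply: ltnn.
- exact: sorted_enum_ord.
- exact: sorted_keys.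
- by move=> x; rewrite mem_enum all_t.
Qed.

End DecreasingPriorities.

(** Keeping [m] apart from the number of terms leaves the summand fixed during the induction; [m] is
    set to [n] afterwards. *)
Lemma sum_linear (R : numFieldType) (n : nat) (m : R) :
  \sum_(i < n) (m - i%:R) = m * n%:R - n%:R * (n%:R - 1) / 2.
Proof.
elim: n => [|n IHn]; first by rewrite big_ord0; field.
by rewrite big_ord_recr /= IHn -natr1; field.
Qed.

Lemma sum_linear_depth (R : numFieldType) (n : nat) (m : R) :
  \sum_(i < n) (m - i%:R) * i.+1%:R =
  m * (n%:R * (n%:R + 1)) / 2 - (n%:R - 1) * n%:R * (n%:R + 1) / 3.
Proof.
elim: n => [|n IHn]; first by rewrite big_ord0; field.
by rewrite big_ord_recr /= IHn -natr1; field.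
Qed.

Theorem mainTheorem6 (R : realType) :
  exists (c : R) (n0 : nat), 0 < c /\
    forall n : nat, (n0 <= n)%N ->
      exists p : 'I_n -> R,
        [/\ is_distribution p, injective p
          & exists T : tree 'I_n,
              unique (is_treap p) T /\
              c * n%:R <= expected_access_time p T].
Proof.
(* The expected depth [(n + 2) / 3] gives the constant 1/3; [n >= 1] makes the normalising sum [S]
   positive. *)
exists 3^-1, 1; split=> [|n n_gt0]; first by rewrite invr_gt0.
have n_pos : 0 < n%:R :> R by rewrite ltr0n.
pose S : R := \sum_(i < n) (n%:R - i%:R).
have SE : S = n%:R * (n%:R + 1) / 2 by rewrite /S sum_linear; field.
have S_pos : 0 < S by rewrite SE divr_gt0 ?mulr_gt0 // addr_gt0.
pose p (i : 'I_n) : R := (n%:R - i%:R) / S.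
have p_decr (i j : 'I_n) : (i < j)%N -> p j < p i.
  by move=> ij; rewrite ltr_pM2r ?invr_gt0 // ltrD2l ltrN2 ltr_nat.
exists p; split; last exists (right_path (enum 'I_n)); last split.
- split=> [i|]; last by rewrite -mulr_suml divff // gt_eqF.
  by apply: divr_ge0 (ltW S_pos); rewrite subr_ge0 ler_nat ltnW.
- exact: decreasing_pri_inj p_decr.
- exact: decreasing_treap_unique.
rewrite /expected_access_time.
under eq_bigr => i _ do rewrite depth_right_path /p mulrAC.
(* Cleared of the denominator [S], the bound compares [n^2 (n + 1) / 6] with
   [n (n + 1) (n + 2) / 6]. *)
rewrite -mulr_suml sum_linear_depth ler_pdivlMr // SE; nra.
Qed.
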